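(* Let $X_1,\dots,X_n\in\mathbb{R}^d$ be independent random vectors, each with independent sub-Gaussian coordinates. Let $\mu_i=\mathbb{E}X_i$, $M=(\mu_1\mid\cdots\mid\mu_n)\in\mathbb{R}^{d\times n}$, and $\kappa=\max_{i,k}\|X_{ik}-\mathbb{E}X_{ik}\|_{\psi_2}$. Let $A=(a_{ij})\in\mathbb{R}^{n\times n}$, $A^{\mathsf S}=(A+A^T)/2$, and $Z=\sum_{i,j}a_{ij}\langle X_i,X_j\rangle$. Then there is a universal constant $c>0$ such that for any $t\ge0$, $$\mathbb{P}\big(|Z-\mathbb{E}Z|\ge\kappa^2t\big)\le4\exp\Big[-c\min\Big(\frac{t^2}{d\|A\|_F^2+\kappa^{-2}\|MA^{\mathsf S}\|_F^2},\ \frac{t}{\|A\|}\Big)\Big].$$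
   Context: $\|\cdot\|_{\psi_2}$ is the sub-Gaussian norm, $\|\cdot\|_F$ the Frobenius norm, $\|\cdot\|$ the spectral norm. *)

(* Defs.v *)
From HB Require Import structures.
From mathcomp Require Import all_boot all_order all_algebra.
From mathcomp Require Import all_classical all_reals all_analysis.
Set Implicit Arguments. Unset Strict Implicit. Unset Printing Implicit Defensive.
Import Order.TTheory GRing.Theory Num.Theory.
Import numFieldNormedType.Exports.
Local Open Scope classical_set_scope.
Local Open Scope ring_scope.

Definition mutually_independent {d} {T : measurableType d} {R : realType}
  (P : probability T R) (I : finType) (Y : I -> T -> R) : Prop :=
  (forall i, measurable_fun setT (Y i)) /\
  forall (J : {set I}) (B : I -> set R), (forall i, measurable (B i)) ->
    P (\bigcap_(i in [set j | j \in J]) (Y i @^-1` B i)) =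
    (\prod_(i in J) P (Y i @^-1` B i))%E.

Definition psi2_scales {d} {T : measurableType d} {R : realType}
  (P : probability T R) (Y : T -> R) : set R :=
  [set s : R | 0 < s /\ ('E_P[fun w => expR (Y w ^+ 2 / s ^+ 2)] <= 2%:E)%E].

Definition subgaussian {d} {T : measurableType d} {R : realType}
  (P : probability T R) (Y : T -> R) : Prop := psi2_scales P Y !=set0.

Definition psi2_norm {d} {T : measurableType d} {R : realType}
  (P : probability T R) (Y : T -> R) : R := inf (psi2_scales P Y).

Definition Ef {d} {T : measurableType d} {R : realType}
  (P : probability T R) (Y : T -> R) : R := fine ('E_P[Y])%E.

Definition frob2 {R : realType} {m n : nat} (A : 'M[R]_(m, n)) : R :=
  \sum_(i < m) \sum_(j < n) A i j ^+ 2.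

Definition eucl {R : realType} {n : nat} (x : 'cV[R]_n) : R :=
  Num.sqrt (\sum_(i < n) x i ord0 ^+ 2).

Definition spec_norm {R : realType} {m n : nat} (A : 'M[R]_(m, n)) : R :=
  sup [set eucl (A *m x) | x in [set x : 'cV[R]_n | eucl x = 1]].

(* Main.v *)
Require Import Defs.
From HB Require Import structures.
From mathcomp Require Import all_boot all_order all_algebra.
From mathcomp Require Import all_classical all_reals all_analysis.
From mathcomp Require Import measurable_realfun.
From mathcomp Require Import ring lra.
Import Order.TTheory GRing.Theory Num.Theory.
Import numFieldNormedType.Exports.
Local Open Scope classical_set_scope.
Local Open Scope ring_scope.

(** Normalise [Y_ik = (X_ik - mu_ik) / (2 kappa)], so that [E exp (Y^2) <= 2].
    Then [Z - E Z] is, up to the factor [4 kappa^2], a centred quadratic form of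
    matrix [A^S (x) I_d] in [Y] plus a linear form with coefficients
    [M A^S / kappa].  The moment generating function of such an expression is
    bounded without decoupling, by integrating out one coordinate at a time: for
    a sub-Gaussian variable,
    [E exp (a (Y^2 - E Y^2) + b Y) <= exp (D (a^2 + b^2))], and here [b] is the
    row of the coordinate applied to the remaining ones, so [D b^2] is a rank
    one update of the remaining form.  This update preserves the operator bound
    of the form, and the Hilbert-Schmidt norm decreases enough to pay for all
    the terms created by recentring.  Chernoff's bound concludes; that the
    expression has mean zero is itself read off its moment generating function. *)

(** * Elementary inequalities for the exponential *)

Section exponential_inequalities.
Context {R : realType}.
Implicit Types x y theta : R.

(** From $e^{-x} \ge 1-x$ one gets $e^x \le 1/(1-x)$, and $(1+x+2x^2)(1-x) = 1 + x^2(1-2x)$ is at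
    least 1 in this range. *)
Lemma expR_le_quad x : x <= 2^-1 -> expR x <= 1 + x + 2 * x ^+ 2.
Proof.
move=> x2; have e1 := expR_ge1Dx (- x).
have e2 : expR x * expR (- x) = 1 by rewrite -expRD subrr expR0.
have e0 := expR_gt0 x.
have : expR x * (1 - x) <= 1 by rewrite -[leRHS]e2 ler_pM2l.
have x1 : 0 < 1 - x by lra.
rewrite -ler_pdivlMr// => /le_trans; apply.
rewrite ler_pdivrMr//.
have : 0 <= x ^+ 2 * (1 - 2 * x) by rewrite mulr_ge0 ?sqr_ge0//; lra.
nra.
Qed.

(** Isolates the linear term, which integrates to 0 for a centred variable, and leaves an
    exponential of a square, which the sub-Gaussian hypothesis controls. *)
Lemma expR_le_expRsqr x : expR x <= x + expR (2 * x ^+ 2).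
Proof.
have [x2|x2] := lerP x 2^-1.
  have := expR_ge1Dx (2 * x ^+ 2); have := expR_le_quad _ x2; lra.
have : expR x <= expR (2 * x ^+ 2) by rewrite ler_expR; nra.
lra.
Qed.

(** Meant for $x$ of the order of $Y^2$, where $\exp(2x^2)$ is out of reach of a bound on
    $E\exp(Y^2)$: the remainder is only exponential in $|x|$, and its factor $x^2$ keeps the
    smallness. *)
Lemma expR_le_quad_expR x : expR x <= 1 + x + 4 * x ^+ 2 * expR `|x|.
Proof.
have x0 := sqr_ge0 x.
have [x2|x2] := lerP x 2^-1.
  have e1 : 1 <= expR `|x| by rewrite -expR0 ler_expR.
  have := expR_le_quad _ x2; nra.
have e0 := expR_gt0 x.
rewrite ger0_norm; last lra.
have : 1 <= 4 * x ^+ 2 by nra.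
nra.
Qed.

(** The tangent at [theta * x], evaluated at [x] and at 0 and averaged with weights [theta] and
    [1 - theta], gives the chord bound. *)
Lemma expR_convex theta x : 0 <= theta <= 1 ->
  expR (theta * x) <= 1 - theta + theta * expR x.
Proof.
move=> /andP[t0 t1].
have e0 := expR_gt0 (theta * x).
have e1 : expR x = expR (theta * x) * expR ((1 - theta) * x).
  by rewrite -expRD -mulrDl addrC subrK mul1r.
have e2 : 1 = expR (theta * x) * expR (- (theta * x)).
  by rewrite -expRD subrr expR0.
have h1 := ler_wpM2l (ltW e0) (expR_ge1Dx ((1 - theta) * x)).
have h2 := ler_wpM2l (ltW e0) (expR_ge1Dx (- (theta * x))).
rewrite -e1 in h1; rewrite -e2 in h2.
have h3 := ler_wpM2l t0 h1.
have h4 : (1 - theta) * (expR (theta * x) * (1 - theta * x)) <= (1 - theta) * 1.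
  by apply: ler_wpM2l; [lra|exact: h2].
lra.
Qed.

Lemma expRD_le x y : expR (x + y) <= 2^-1 * (expR (2 * x) + expR (2 * y)).
Proof.
rewrite !expRM_natl expRD.
have := sqr_ge0 (expR x - expR y); nra.
Qed.

Lemma expR_mul_sqr_le x b : expR (b * x) <= expR (b ^+ 2 / 4) * expR (x ^+ 2).
Proof.
by rewrite -expRD ler_expR; have := sqr_ge0 (x - b / 2); nra.
Qed.

Lemma sqr_le_expR x : 0 <= x -> x ^+ 2 <= 16 * expR (x / 2).
Proof.
move=> x0; have -> : x / 2 = 2 * (x / 4) by lra.
by have := expR_ge1Dx (x / 4); rewrite expRM_natl; nra.
Qed.

(** With $x = |v|$, the square costs $16 e^{x/2}$ and $|a| \le 1/4$ leaves $e^{x/4}$; the product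
    stays below $16 e^x$. *)
Lemma expR_absorb_sqr (a v : R) : `|a| <= 4^-1 ->
  4 * (a * v) ^+ 2 * expR `|a * v| <= 64 * a ^+ 2 * expR `|v|.
Proof.
move=> a4; rewrite -(real_normK (num_real (a * v))) -(real_normK (num_real a)) normrM.
move: `|a| `|v| (normr_ge0 a) (normr_ge0 v) a4 => b x b0 x0 b4.
have e1 : expR (b * x) <= expR (x / 4) by rewrite ler_expR; nra.
have e2 := sqr_le_expR _ x0.
have h1 : x ^+ 2 * expR (b * x) <= (16 * expR (x / 2)) * expR (x / 4).
  by apply: ler_pM; rewrite ?sqr_ge0 ?expR_ge0.
have e3 : expR (x / 2) * expR (x / 4) <= expR x by rewrite -expRD ler_expR; lra.
rewrite exprMn.
have h2 : x ^+ 2 * expR (b * x) <= 16 * expR x by lra.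
have := ler_wpM2l (sqr_ge0 b) h2; lra.
Qed.

End exponential_inequalities.

(** * Moment generating functions of one sub-Gaussian variable and of its square *)

Section one_variable.
Context {dsp : measure_display} {T : measurableType dsp} {R : realType}.
Variables (P : probability T R) (Y : T -> R).
Hypotheses (mY : measurable_fun setT Y)
  (expY : (\int[P]_w (expR (Y w ^+ 2))%:E <= 2%:E)%E).

Let mexpY : measurable_fun setT (fun w => expR (Y w ^+ 2)).
Proof. by apply: measurableT_comp => //; exact: measurable_funX. Qed.

Lemma integrable_expR_sqr : P.-integrable setT (fun w => (expR (Y w ^+ 2))%:E).
Proof.
apply/integrableP; split; first exact/measurable_EFinP.
apply: le_lt_trans (ltry 2).
rewrite (eq_integral (fun w => (expR (Y w ^+ 2))%:E))// => w _.
by rewrite gee0_abs// lee_fin expR_ge0.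
Qed.

Lemma integrable_le_expR_sqr (U : T -> R) : measurable_fun setT U ->
  (forall w, `|U w| <= expR (Y w ^+ 2)) -> P.-integrable setT (EFin \o U).
Proof.
move=> mU Ule; apply: le_integrable integrable_expR_sqr => //.
- exact/measurable_EFinP.
- by move=> w _ /=; rewrite lee_fin (le_trans (Ule w))// ler_norm.
Qed.

Lemma integrable_subgaussian : P.-integrable setT (EFin \o Y).
Proof.
apply: integrable_le_expR_sqr => // w.
apply: le_trans (expR_ge1Dx _).
by have := sqr_ge0 (`|Y w| - 2^-1); rewrite -(real_normK (num_real (Y w))); nra.
Qed.

Lemma integrable_sqr_subgaussian :
  P.-integrable setT (EFin \o (fun w => Y w ^+ 2)).
Proof.
apply: integrable_le_expR_sqr => [|w]; first exact: measurable_funX.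
rewrite ger0_norm ?sqr_ge0//; apply: le_trans (expR_ge1Dx _); lra.
Qed.

(** Common scheme of the moment bounds below: a pointwise majorant made of a mean-zero term [U] and
    an affine function of $\exp(Y^2)$ is integrated term by term. *)
Lemma integral_le_centered (U f : T -> R) (p q : R) :
  0 <= q -> P.-integrable setT (EFin \o U) -> (\int[P]_w (U w)%:E = 0)%E ->
  measurable_fun setT f -> (forall w, 0 <= f w) ->
  (forall w, f w <= U w + (p + q * expR (Y w ^+ 2))) ->
  (\int[P]_w (f w)%:E <= (p + q * 2)%:E)%E.
Proof.
move=> q0 iU U0 mf f0 fle.
have ig : P.-integrable setT (fun w => q%:E * (expR (Y w ^+ 2))%:E)%E.
  exact: (integrableZl measurableT q integrable_expR_sqr).
have ip : P.-integrable setT (cst p%:E).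
  by apply: finite_measure_integrable_cst.
have igp := integrableD measurableT ip ig.
have iUgp := integrableD measurableT iU igp.
apply: (@le_trans _ _ (\int[P]_w ((EFin \o U) \+
    (cst p%:E \+ (fun w => q%:E * (expR (Y w ^+ 2))%:E))) w)%E).
  apply: ge0_le_integral => //.
  - by move=> w _; rewrite lee_fin.
  - exact/measurable_EFinP.
  - by case/integrableP: iUgp.
  - by move=> w _; rewrite /= -EFinM -!EFinD lee_fin.
rewrite integralD// [X in (X + _)%E]U0 add0e integralD//.
rewrite integral_cst//= probability_setT mule1 integralZl//; last first.
  exact: integrable_expR_sqr.
by rewrite EFinD leeD2l// EFinM lee_wpmul2l.
Qed.

Lemma integral_le_affine_exp (f : T -> R) (p q : R) :
  0 <= q -> measurable_fun setT f -> (forall w, 0 <= f w) ->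
  (forall w, f w <= p + q * expR (Y w ^+ 2)) ->
  (\int[P]_w (f w)%:E <= (p + q * 2)%:E)%E.
Proof.
move=> q0 mf f0 fle; apply: (@integral_le_centered (cst 0)) => //.
- exact: integrable0.
- by rewrite integral0.
- by move=> w; rewrite add0r.
Qed.

Lemma second_moment_ge0 : 0 <= Ef P (fun w => Y w ^+ 2).
Proof.
by rewrite /Ef unlock fine_ge0// integral_ge0// => w _; rewrite lee_fin sqr_ge0.
Qed.

Lemma EFin_second_moment :
  (\int[P]_w (Y w ^+ 2)%:E = (Ef P (fun w => Y w ^+ 2))%:E)%E.
Proof.
rewrite /Ef unlock fineK//; apply: integrable_fin_num => //.
exact: integrable_sqr_subgaussian.
Qed.

Lemma second_moment_le1 : Ef P (fun w => Y w ^+ 2) <= 1.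
Proof.
rewrite -lee_fin -EFin_second_moment.
have -> : 1%:E = (- 1 + 1 * 2 : R)%:E by congr EFin; lra.
apply: integral_le_affine_exp => // [|w|w]; first exact: measurable_funX.
  exact: sqr_ge0.
by have := expR_ge1Dx (Y w ^+ 2); lra.
Qed.

Hypothesis meanY : (\int[P]_w (Y w)%:E = 0)%E.

(** For $2b^2 \le 1$ the term $bY$ is split off and convexity is used with [theta] equal to $2b^2$.
    For larger $b$, $bY \le b^2/4 + Y^2$, and the factor 2 from $E\exp(Y^2)$ is absorbed by
    $\exp(2b^2)$. *)
Lemma subgaussian_linear_mgf (b : R) :
  (\int[P]_w (expR (b * Y w))%:E <= (expR (3 * b ^+ 2))%:E)%E.
Proof.
have b0 := sqr_ge0 b.
have mf : measurable_fun setT (fun w => expR (b * Y w)).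
  by apply: measurableT_comp => //; exact: measurable_funM.
have [b2|b2] := lerP (2 * b ^+ 2) 1.
  apply: (@le_trans _ _ ((1 - 2 * b ^+ 2) + (2 * b ^+ 2) * 2)%:E).
    apply: (@integral_le_centered (fun w => b * Y w)) => //.
    - by rewrite mulr_ge0.
    - rewrite (_ : _ \o _ = (fun w => b%:E * (EFin \o Y) w)%E)//.
      by apply: integrableZl => //; exact: integrable_subgaussian.
    - under eq_integral do rewrite EFinM.
      rewrite integralZl//; last exact: integrable_subgaussian.
      by rewrite meanY mule0.
    - move=> w; apply: (le_trans (expR_le_expRsqr _)); rewrite lerD2l.
      rewrite exprMn mulrA; apply: expR_convex; lra.
  rewrite lee_fin; apply: le_trans (expR_ge1Dx _); lra.
apply: (@le_trans _ _ (0 + expR (b ^+ 2 / 4) * 2)%:E).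
  apply: integral_le_affine_exp => // w.
  by rewrite add0r; exact: expR_mul_sqr_le.
rewrite lee_fin add0r.
apply: (@le_trans _ _ (expR (b ^+ 2 / 4) * expR (2 * b ^+ 2))).
  rewrite ler_wpM2l ?expR_ge0//; apply: le_trans (expR_ge1Dx _); lra.
by rewrite -expRD ler_expR; lra.
Qed.

(** The linear term is centred. Since $|Y^2 - m| \le 1 + Y^2$, the remainder is at most $64 a^2 e
    \exp(Y^2)$, whose integral is at most $128\, e\, a^2$. *)
Lemma subgaussian_square_mgf (a : R) : `|a| <= 4^-1 ->
  (\int[P]_w (expR (a * (Y w ^+ 2 - Ef P (fun w => Y w ^+ 2))))%:E <=
   (expR (128 * expR 1 * a ^+ 2))%:E)%E.
Proof.
move=> a4; set m := Ef _ _.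
have m0 : 0 <= m := second_moment_ge0.
have m1 : m <= 1 := second_moment_le1.
have a0 := sqr_ge0 a.
have iY := integrable_sqr_subgaussian.
apply: (@le_trans _ _ (1 + (64 * a ^+ 2 * expR 1) * 2)%:E); last first.
  by rewrite lee_fin; apply: le_trans (expR_ge1Dx _); lra.
have im : P.-integrable setT (cst m%:E) by exact: finite_measure_integrable_cst.
pose V w := Y w ^+ 2 - m.
have VE : EFin \o V = ((EFin \o (fun w => (Y w ^+ 2)%R)) \- cst m%:E)%E by [].
have iV : P.-integrable setT (EFin \o V) by rewrite VE; exact: integrableB.
have V0 : (\int[P]_w (V w)%:E = 0)%E.
  rewrite (eq_integral ((EFin \o (fun w => (Y w ^+ 2)%R)) \- cst m%:E)%E)//.
  rewrite integralB// [X in (X - _)%E]EFin_second_moment.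
  by rewrite integral_cst//= probability_setT mule1 subee.
apply: (@integral_le_centered (fun w => a * V w)).
- by rewrite mulr_ge0 ?expR_ge0// mulr_ge0.
- rewrite (_ : _ \o _ = (fun w => a%:E * (EFin \o V) w)%E)//.
  exact: integrableZl.
- under eq_integral do rewrite EFinM.
  by rewrite integralZl// V0 mule0.
- apply: measurableT_comp => //; apply: measurable_funM => //.
  by apply: measurable_funB => //; exact: measurable_funX.
- by move=> w; exact: expR_ge0.
move=> w; apply: (le_trans (expR_le_quad_expR _)).
rewrite addrA [1 + _]addrC lerD2l.
rewrite /V; set v := Y w ^+ 2 - m.
have v1 : `|v| <= 1 + Y w ^+ 2.
  rewrite ler_norml /v; move: (Y w ^+ 2) (m) (sqr_ge0 (Y w)) m0 m1 => y k y0 k0 k1.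
  by apply/andP; split; lra.
rewrite -[leRHS]mulrA -expRD.
apply: (@le_trans _ _ (64 * a ^+ 2 * expR `|v|)); last first.
  by rewrite ler_wpM2l ?ler_expR// mulr_ge0.
exact: expR_absorb_sqr.
Qed.

(** The square and the linear term are separated by $e^{x+y} \le (e^{2x}+e^{2y})/2$. Doubling the
    arguments turns $128 e$ into $512 e$ and halves the admissible range of [a]. *)
Lemma subgaussian_mgf (a b : R) : `|a| <= 8^-1 ->
  (\int[P]_w (expR (a * (Y w ^+ 2 - Ef P (fun w => Y w ^+ 2)) + b * Y w))%:E <=
   (expR (512 * expR 1 * (a ^+ 2 + b ^+ 2)))%:E)%E.
Proof.
move=> a8; set m := Ef _ _.
have m1 : measurable_fun setT (fun w => expR (2 * a * (Y w ^+ 2 - m))).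
  apply: measurableT_comp => //; apply: measurable_funM => //.
  by apply: measurable_funB => //; exact: measurable_funX.
have m2 : measurable_fun setT (fun w => expR (2 * b * Y w)).
  by apply: measurableT_comp => //; exact: measurable_funM.
apply: (@le_trans _ _ (2^-1%:E * (\int[P]_w (expR (2 * a * (Y w ^+ 2 - m)))%:E +
    \int[P]_w (expR (2 * b * Y w))%:E))%E).
  have f0 (c : T -> R) : (forall w, setT w -> 0 <= (expR (c w))%:E)%E.
    by move=> w _; rewrite lee_fin expR_ge0.
  rewrite -(ge0_integralD _ _ (f0 _) _ (f0 _)) //;
    [|exact/measurable_EFinP|exact/measurable_EFinP].
  rewrite -ge0_integralZl ?lee_fin//; last first.
  - by move=> w _; rewrite -EFinD lee_fin addr_ge0 ?expR_ge0.
  - by apply: emeasurable_funD; exact/measurable_EFinP.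
  apply: ge0_le_integral => //.
  - apply/measurable_EFinP; apply: measurableT_comp => //.
    apply: measurable_funD; apply: measurable_funM => //.
    by apply: measurable_funB => //; exact: measurable_funX.
  - apply: measurable_funeM; apply: emeasurable_funD; exact/measurable_EFinP.
  - move=> w _; rewrite -EFinD -EFinM lee_fin -!(mulrA 2).
    exact: expRD_le.
have e1 : 1 <= expR 1 :> R by rewrite -expR0 ler_expR.
have a0 := sqr_ge0 a; have b0 := sqr_ge0 b.
apply: (@le_trans _ _ (2^-1%:E * ((expR (512 * expR 1 * (a ^+ 2 + b ^+ 2)))%:E
    + (expR (512 * expR 1 * (a ^+ 2 + b ^+ 2)))%:E))%E); last first.
  by rewrite -EFinD -EFinM lee_fin; lra.
rewrite lee_wpmul2l ?lee_fin//; apply: leeD.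
  have a4 : `|2 * a| <= 4^-1 by rewrite normrM ger0_norm//; lra.
  apply: (le_trans (subgaussian_square_mgf _ a4)).
  rewrite lee_fin ler_expR; nra.
apply: (le_trans (subgaussian_linear_mgf _)).
rewrite lee_fin ler_expR; nra.
Qed.

End one_variable.

(** * Freezing an independent variable: Tonelli without conditional expectations *)

Section fubini.
Context {dsp : measure_display} {T : measurableType dsp} {R : realType}.
Variables (P : probability T R) (xi : T -> R) (G : set (set T)).
Hypotheses (mxi : measurable_fun setT xi) (mG : G `<=` measurable)
  (GI : setI_closed G) (GT : G setT).
Hypothesis ind : forall B C, measurable B -> G C ->
  P (xi @^-1` B `&` C) = (P (xi @^-1` B) * P C)%E.

Local Notation T' := (g_sigma_algebraType G).

Lemma measurable_g_sigma_id : measurable_fun setT (idfun : T -> T').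
Proof.
move=> _ C mC; rewrite setTI preimage_id.
by move: mC; apply: smallest_sub => //; exact: sigma_algebra_measurable.
Qed.

Lemma measurable_pair_id :
  measurable_fun setT ((fun w => (xi w, w)) : T -> R * T').
Proof.
apply/measurable_fun_pairP; split => //=.
exact: measurable_g_sigma_id.
Qed.

Let I' : {mfun T >-> T'} := mfun_Sub (mem_set measurable_g_sigma_id).
Let XI : {mfun T >-> R} := mfun_Sub (mem_set mxi).
Let PI : {mfun T >-> (R * T')%type} := mfun_Sub (mem_set measurable_pair_id).

(** Both sides are finite measures in [C], a restriction and a multiple of [P], that agree on the
    $\pi$-system [G]; hence they agree on the sigma-algebra it generates. *)
Lemma indep_sigma B C : measurable B -> (<<s G >>) C ->
  P (xi @^-1` B `&` C) = (P (xi @^-1` B) * P C)%E.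
Proof.
move=> mB sC.
have mD : measurable (xi @^-1` B) by rewrite -[X in measurable X]setTI; exact: mxi.
have r0 : 0 <= fine (P (xi @^-1` B)) by rewrite fine_ge0.
have PD : P (xi @^-1` B) = (fine (P (xi @^-1` B)))%:E.
  by rewrite fineK// fin_num_measure.
rewrite PD setIC.
apply: (@g_sigma_algebra_measure_unique _ _ _ G mG (fun=> setT) _ _
  (mrestr P mD) (mscale (NngNum r0) P)) => //.
- by rewrite bigcup_const//; exists 0%N.
- move=> A GA.
  change (P (A `&` xi @^-1` B) = (fine (P (xi @^-1` B)))%:E * P A)%E.
  by rewrite -PD -ind// setIC.
- move=> _; change (P (setT `&` xi @^-1` B) < +oo)%E.
  by rewrite setTI -ge0_fin_numE// fin_num_measure.
Qed.

(** The identity map into [T'], the same space with the smaller sigma-algebra, plays the part of a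
    random variable carrying all the information in [G]. It is independent of [xi], so the joint law
    is a product and Tonelli integrates out [xi] first. *)
Lemma integral_pair_indep_le (F : (R * T')%type -> \bar R) (H : T' -> \bar R) :
  measurable_fun setT F -> (forall z, 0 <= F z)%E ->
  measurable_fun setT H -> (forall w, \int[P]_w' F (xi w', w) <= H w)%E ->
  (\int[P]_w F (xi w, w) <= \int[P]_w H w)%E.
Proof.
move=> mF F0 mH FH.
have int0 w : (0 <= \int[P]_w' F (xi w', w))%E by exact: integral_ge0.
have -> : (\int[P]_w F (xi w, w) = \int[distribution P PI]_z F z)%E.
  by rewrite ge0_integral_distribution.
have -> : (\int[distribution P PI]_z F z =
    \int[distribution P XI \x distribution P I']_z F z)%E.
  apply: eq_measure_integral => A mA _; apply/esym.
  by apply: product_measure_unique => // B C mB mC; exact: indep_sigma.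
have H0 w : (0 <= H w)%E by exact: le_trans (FH w).
rewrite fubini_tonelli2//.
have -> : (\int[P]_w H w = \int[distribution P I']_w H w)%E.
  by rewrite ge0_integral_distribution.
apply: ge0_le_integral => //.
- by move=> y _; apply: integral_ge0.
- exact: measurable_fun_fubini_tonelli_G.
- move=> w _; rewrite /fubini_G ge0_integral_distribution//; first exact: FH.
  exact: measurableT_comp.
Qed.

End fubini.

(** * Independence of one coordinate from a list of others *)

Section cylinders.
Context {dsp : measure_display} {T : measurableType dsp} {R : realType}.
Variables (P : probability T R) (I : finType) (Y : I -> T -> R).

(** A $\pi$-system generating the sigma-algebra of the coordinates in [s]; measurability on the
    generated space encodes dependence on these coordinates only. *)
Definition cylinders (s : seq I) : set (set T) :=
  [set C | exists2 B : I -> set R, forall j, measurable (B j) &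
     C = \bigcap_(j in [set j | j \in s]) (Y j @^-1` B j)].

Lemma measurable_cylinders s : (forall j, measurable_fun setT (Y j)) ->
  cylinders s `<=` measurable.
Proof.
move=> mY _ [B mB ->].
apply: fin_bigcap_measurable => [|j _]; first exact: finite_finset.
by rewrite -[X in measurable X]setTI; exact: mY.
Qed.

Lemma cylinders_setI s : setI_closed (cylinders s).
Proof.
move=> _ _ [B mB ->] [C mC ->]; exists (fun j => B j `&` C j).
  by move=> j; exact: measurableI.
by rewrite -bigcapI.
Qed.

Lemma cylinders_setT s : cylinders s setT.
Proof.
exists (fun=> setT) => [j|]; first exact: measurableT.
by apply/seteqP; split => // w _ j _.
Qed.

Lemma measurable_cylinder_coord s j : j \in s ->
  measurable_fun setT (Y j : g_sigma_algebraType (cylinders s) -> R).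
Proof.
move=> js _ B mB; rewrite setTI; apply: sub_gen_smallest.
exists (fun k => if k == j then B else setT) => [k|].
  by case: ifP => // _; exact: measurableT.
apply/seteqP; split => [w Bw k _|w /(_ j js)]; last by rewrite /= eqxx.
by rewrite /=; case: eqP => // ->.
Qed.

Hypothesis indY : mutually_independent P Y.

Lemma cylinders_indep i s B C : i \notin s ->
  measurable B -> cylinders s C ->
  P (Y i @^-1` B `&` C) = (P (Y i @^-1` B) * P C)%E.
Proof.
move=> is_ mB [Bs mBs ->].
have [_ indP] := indY.
(* The single family [B'] serves both for [s] and for [s] with [i] added, so that [indP] factors
   both sides and the products differ by the factor of [i]. *)
pose B' j := if j == i then B else Bs j.
have mB' j : measurable (B' j) by rewrite /B'; case: ifP.
have B's j : j \in s -> B' j = Bs j.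
  by rewrite /B' => js; case: eqP => // ji; rewrite -ji js in is_.
have -> : \bigcap_(j in [set j | j \in s]) (Y j @^-1` Bs j) =
    \bigcap_(j in [set j | j \in [set x in s]%SET]) (Y j @^-1` B' j).
  apply/seteqP; split => w sw j /=; rewrite ?inE => js.
    by rewrite B's//; exact: sw.
  by rewrite -B's//; apply: sw; rewrite /= inE.
have -> : Y i @^-1` B `&` \bigcap_(j in [set j | j \in [set x in s]%SET]) (Y j @^-1` B' j)
   = \bigcap_(j in [set j | j \in (i |: [set x in s])%SET]) (Y j @^-1` B' j).
  apply/seteqP; split => [w [Bw sw] j /=|w sw].
    by rewrite !inE => /orP[/eqP->|js]; [rewrite /B' eqxx|apply: sw; rewrite /= inE].
  split; first by have := sw i; rewrite /= !inE eqxx /B' eqxx; exact.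
  by move=> j /= js; apply: sw; rewrite /= !inE in js *; rewrite js orbT.
rewrite !indP// big_setU1 ?inE//=.
by rewrite {1}/B' eqxx.
Qed.

Lemma integral_cylinder_pair_le i s
    (F : (R * g_sigma_algebraType (cylinders s))%type -> \bar R)
    (H : g_sigma_algebraType (cylinders s) -> \bar R) :
  i \notin s -> measurable_fun setT F -> (forall z, 0 <= F z)%E ->
  measurable_fun setT H -> (forall w, \int[P]_w' F (Y i w', w) <= H w)%E ->
  (\int[P]_w F (Y i w, w) <= \int[P]_w H w)%E.
Proof.
have [mY _] := indY.
move=> is_; apply: integral_pair_indep_le => //.
- exact: measurable_cylinders.
- exact: cylinders_setI.
- exact: cylinders_setT.
- by move=> B C; exact: cylinders_indep.
Qed.

(* Conditionally on the coordinates in [s], only [Y i] is random. *)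
Lemma integrate_out i s (D a0 m2 a : R)
    (b c : g_sigma_algebraType (cylinders s) -> R) :
  i \notin s -> measurable_fun setT b -> measurable_fun setT c ->
  (forall x y, `|x| <= a0 ->
    (\int[P]_w (expR (x * (Y i w ^+ 2 - m2) + y * Y i w))%:E <=
      (expR (D * (x ^+ 2 + y ^+ 2)))%:E)%E) ->
  `|a| <= a0 ->
  (\int[P]_w (expR (a * (Y i w ^+ 2 - m2) + b w * Y i w + c w))%:E <=
   \int[P]_w (expR (D * (a ^+ 2 + b w ^+ 2) + c w))%:E)%E.
Proof.
move=> is_ mb mc H aa0.
have [mY _] := indY.
pose F (z : R * g_sigma_algebraType (cylinders s)) :=
  (expR (a * (z.1 ^+ 2 - m2) + b z.2 * z.1 + c z.2))%:E.
have mF : measurable_fun setT F.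
  apply/measurable_EFinP; apply: measurableT_comp => //.
  apply: measurable_funD; last exact: measurableT_comp.
  apply: measurable_funD.
    apply: measurable_funM => //; apply: measurable_funB => //.
    exact: measurable_funX.
  by apply: measurable_funM => //; exact: measurableT_comp.
apply: (@integral_cylinder_pair_le i s F) => //.
- by move=> z; rewrite lee_fin expR_ge0.
- apply/measurable_EFinP; apply: measurableT_comp => //.
  apply: measurable_funD => //; apply: measurable_funM => //.
  by apply: measurable_funD => //; exact: measurable_funX.
move=> w; rewrite /F /=.
under eq_integral do rewrite expRD EFinM.
rewrite ge0_integralZr//.
- by rewrite expRD EFinM lee_wpmul2r// ?lee_fin ?expR_ge0//; exact: H.
- apply/measurable_EFinP; apply: measurableT_comp => //.
  apply: measurable_funD; apply: measurable_funM => //.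
  by apply: measurable_funB => //; exact: measurable_funX.
Qed.

End cylinders.

(** * Quadratic forms over a list of indices and their rank one updates *)

Section quadratic_forms.
Context {R : realType} {I : eqType}.
Implicit Types (s : seq I) (Q : I -> I -> R) (x y q : I -> R).

Definition lin_form s q x : R := \sum_(j <- s) q j * x j.
Definition quad_form s Q x : R := \sum_(j <- s) \sum_(k <- s) Q j k * x j * x k.
Definition sum_sqr s x : R := \sum_(j <- s) x j ^+ 2.
Definition hs_sqr s Q : R := \sum_(j <- s) \sum_(k <- s) Q j k ^+ 2.
(** For a symmetric [Q] and a duplicate-free [s], this bounds the operator norm of the block of [Q]
    on [s]. *)
Definition form_le (nu : R) s Q :=
  forall x, `|quad_form s Q x| <= nu * sum_sqr s x.
Definition rank1_update (c : R) q Q : I -> I -> R :=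
  fun j k => Q j k + c * (q j * q k).

Lemma sum_sqr_ge0 s x : 0 <= sum_sqr s x.
Proof. by apply: sumr_ge0 => j _; exact: sqr_ge0. Qed.

Lemma lin_formxx s x : lin_form s x x = sum_sqr s x.
Proof. by apply: eq_bigr => j _; rewrite expr2. Qed.

Lemma quad_form_cons i s Q x : (forall j k, Q j k = Q k j) ->
  quad_form (i :: s) Q x =
  Q i i * x i ^+ 2 + 2 * x i * lin_form s (Q i) x + quad_form s Q x.
Proof.
move=> Qsym; rewrite /quad_form big_cons big_cons.
under [X in _ + X = _]eq_bigr do rewrite big_cons.
rewrite big_split /= addrA; congr (_ + _).
have -> : \sum_(j <- s) Q j i * x j * x i = x i * lin_form s (Q i) x.
  by rewrite mulr_sumr; apply: eq_bigr => j _; rewrite (Qsym j i); ring.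
have -> : \sum_(j <- s) Q i j * x i * x j = x i * lin_form s (Q i) x.
  by rewrite mulr_sumr; apply: eq_bigr => j _; ring.
ring.
Qed.

Lemma hs_sqr_cons i s Q : (forall j k, Q j k = Q k j) ->
  hs_sqr (i :: s) Q = Q i i ^+ 2 + 2 * sum_sqr s (Q i) + hs_sqr s Q.
Proof.
move=> Qsym; rewrite /hs_sqr big_cons big_cons.
under [X in _ + X = _]eq_bigr do rewrite big_cons.
rewrite big_split /= addrA; congr (_ + _).
have -> : \sum_(j <- s) Q j i ^+ 2 = sum_sqr s (Q i).
  by apply: eq_bigr => j _; rewrite (Qsym j i).
rewrite -/(sum_sqr s (Q i)); ring.
Qed.

Lemma quad_form_rank1 c q s Q x :
  quad_form s (rank1_update c q Q) x = quad_form s Q x + c * lin_form s q x ^+ 2.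
Proof.
rewrite expr2 {1}/lin_form mulr_suml mulr_sumr -big_split /=.
apply: eq_bigr => j _; rewrite /lin_form !mulr_sumr -big_split /=.
by apply: eq_bigr => k _; rewrite /rank1_update; ring.
Qed.

Lemma hs_sqr_rank1 c q s Q :
  hs_sqr s (rank1_update c q Q) =
  hs_sqr s Q + 2 * c * quad_form s Q q + c ^+ 2 * sum_sqr s q ^+ 2.
Proof.
rewrite [sum_sqr s q ^+ 2]expr2 {1}/sum_sqr mulr_suml !mulr_sumr -!big_split /=.
apply: eq_bigr => j _; rewrite /sum_sqr !mulr_sumr -!big_split /=.
by apply: eq_bigr => k _; rewrite /rank1_update; ring.
Qed.

Variables (nu : R) (i : I) (s : seq I) (Q : I -> I -> R).
Hypotheses (is_ : i \notin s) (Qsym : forall j k, Q j k = Q k j)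
  (nu0 : 0 < nu) (Qnu : form_le nu (i :: s) Q).

(** The hypothesis is tested on the vector equal to [a] at [i] and to [y] on [s]; the lemmas below
    follow by choosing [a]. *)
Lemma form_le_cons a y :
  `|Q i i * a ^+ 2 + 2 * a * lin_form s (Q i) y + quad_form s Q y|
    <= nu * (a ^+ 2 + sum_sqr s y).
Proof.
pose x k := if k == i then a else y k.
have xs j : j \in s -> x j = y j.
  by rewrite /x => js; case: eqP => // ji; move: is_; rewrite -ji js.
have := Qnu x; rewrite quad_form_cons// /sum_sqr big_cons {1 2 5}/x eqxx.
rewrite (_ : lin_form s _ x = lin_form s (Q i) y); last first.
  by apply: eq_big_seq => j js; rewrite xs.
rewrite (_ : quad_form s Q x = quad_form s Q y); last first.
  by apply: eq_big_seq => j js; apply: eq_big_seq => k ks; rewrite !xs.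
rewrite (_ : \sum_(j <- s) x j ^+ 2 = sum_sqr s y)//.
by apply: eq_big_seq => j js; rewrite xs.
Qed.

Lemma form_le_diag : `|Q i i| <= nu.
Proof.
have := form_le_cons 1 (fun=> 0).
rewrite /lin_form /quad_form /sum_sqr !big1 => [|j _|j _|j _].
- by rewrite expr1n !mulr1 !mulr0 !addr0 mulr1.
- by rewrite expr0n.
- by rewrite big1// => k _; rewrite mulr0.
- by rewrite mulr0.
Qed.

(** Comparing the tests at $a = 2\nu$ and $a = -2\nu$ cancels the diagonal entry and the form on
    [s]; with $S$ the squared norm of the row, $8\nu S \le 2\nu(4\nu^2 + S)$ remains. *)
Lemma form_le_row : sum_sqr s (Q i) <= 4 / 3 * nu ^+ 2.
Proof.
have := form_le_cons (2 * nu) (Q i); have := form_le_cons (- (2 * nu)) (Q i).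
rewrite lin_formxx !ler_norml => /andP[h1 _] /andP[_ h2].
have := sum_sqr_ge0 s (Q i); move: h1 h2.
move: (sum_sqr s (Q i)) (quad_form s Q (Q i)) => S q h1 h2 S0.
have : nu * (6 * S) <= nu * (8 * nu ^+ 2) by lra.
by rewrite ler_pM2l//; lra.
Qed.

Lemma form_le_row_quad : quad_form s Q (Q i) <= nu * sum_sqr s (Q i).
Proof.
have := form_le_cons 0 (Q i).
rewrite expr0n/= !mulr0 mul0r !add0r; exact/le_trans/ler_norm.
Qed.

Variable c : R.
Hypotheses (c0 : 0 <= c) (cnu : c * nu <= 2^-1).

(** The added term is nonnegative, so only the upper bound needs care. With $l$ the row form at [y]
    and $d$ the diagonal entry, the test at $a = cl$ gives it, because $c(\nu - d) \le 2c\nu \le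
    1$. *)
Lemma form_le_rank1 : form_le nu s (rank1_update c (Q i) Q).
Proof.
move=> y; rewrite quad_form_rank1.
have := form_le_cons 0 y; have := form_le_cons (c * lin_form s (Q i) y) y.
have := form_le_diag.
rewrite !ler_norml expr0n/= !mulr0 mul0r !add0r.
move: (lin_form _ _ _) (quad_form _ _ _) (sum_sqr _ _) (Q i i) => l q S d.
move=> /andP[d1 d2] /andP[h1 h2] /andP[h3 h4].
have l0 := sqr_ge0 l.
have cl : 0 <= c * l ^+ 2 by rewrite mulr_ge0.
apply/andP; split; first lra.
have : c * l ^+ 2 * (c * (nu - d)) <= c * l ^+ 2 * 1.
  have : 0 <= c * (nu + d) by rewrite mulr_ge0//; lra.
  by move=> cd; have cn := cnu; rewrite ler_wpM2l//; lra.
lra.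
Qed.

(** Removing [i] frees $2S$, with $S$ the squared norm of its row. The cross term of the update
    costs at most $S$ and the quadratic one at most $S/3$, since $c^2 S \le \frac14\cdot\frac43$. *)
Lemma hs_sqr_rank1_le : hs_sqr s (rank1_update c (Q i) Q) <=
  hs_sqr (i :: s) Q - Q i i ^+ 2 - 2 / 3 * sum_sqr s (Q i).
Proof.
rewrite hs_sqr_rank1 hs_sqr_cons//.
have := form_le_row; have := form_le_row_quad; have := sum_sqr_ge0 s (Q i).
move: (sum_sqr _ _) (quad_form _ _ _) (hs_sqr _ _) (Q i i) => S q h d S0 qS Snu.
have h1 : c * q <= 2^-1 * S.
  apply: (@le_trans _ _ (c * (nu * S))); first by rewrite ler_wpM2l.
  by rewrite mulrA ler_wpM2r.
have cc : 0 <= c ^+ 2 by exact: sqr_ge0.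
have cn0 : 0 <= c * nu by rewrite mulr_ge0// ltW.
have h2 : c ^+ 2 * S <= 3^-1.
  apply: (@le_trans _ _ (c ^+ 2 * (4 / 3 * nu ^+ 2))); first by rewrite ler_wpM2l.
  have : (c * nu) ^+ 2 <= 4^-1 by have := cnu; nra.
  by rewrite exprMn; lra.
have h3 : (c ^+ 2 * S) * S <= 3^-1 * S by rewrite ler_wpM2r.
lra.
Qed.

End quadratic_forms.

(** * Moment generating function of a centred quadratic plus linear form *)

Section mgf.
Context {dsp : measure_display} {T : measurableType dsp} {R : realType}.
Variables (P : probability T R) (I : finType) (Y : I -> T -> R).
Variables (D nu : R) (m2 : I -> R).
Hypotheses (indY : mutually_independent P Y)
  (D0 : 0 < D) (nu0 : 0 < nu) (Dnu : 16 * D * nu <= 1)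
  (m2_le1 : forall i, m2 i <= 1)
  (mgfY : forall i x y, `|x| <= nu ->
    (\int[P]_w (expR (x * (Y i w ^+ 2 - m2 i) + y * Y i w))%:E <=
      (expR (D * (x ^+ 2 + y ^+ 2)))%:E)%E).

Lemma measurable_sum_seq d' (T' : measurableType d') (s : seq I)
    (h : I -> T' -> R) : (forall j, j \in s -> measurable_fun setT (h j)) ->
  measurable_fun setT (fun w => \sum_(j <- s) h j w).
Proof.
elim: s => [|i s IH] mh.
  by under eq_fun do rewrite big_nil; exact: measurable_cst.
under eq_fun do rewrite big_cons.
apply: measurable_funD; first by apply: mh; rewrite inE eqxx.
by apply: IH => j js; apply: mh; rewrite inE js orbT.
Qed.

Lemma measurable_lin_form d' (T' : measurableType d') (s : seq I)
    (Z : I -> T' -> R) q : (forall j, j \in s -> measurable_fun setT (Z j)) ->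
  measurable_fun setT (fun w => lin_form s q (fun j => Z j w)).
Proof.
by move=> mZ; apply: measurable_sum_seq => j js; apply: measurable_funM => //; exact: mZ.
Qed.

Lemma measurable_quad_form d' (T' : measurableType d') (s : seq I)
    (Z : I -> T' -> R) Q : (forall j, j \in s -> measurable_fun setT (Z j)) ->
  measurable_fun setT (fun w => quad_form s Q (fun j => Z j w)).
Proof.
move=> mZ; apply: measurable_sum_seq => j js; apply: measurable_sum_seq => k ks.
by apply: measurable_funM; [apply: measurable_funM => //|]; exact: mZ.
Qed.

(** Only the diagonal is recentred: [m2] stands for the second moments, and off-diagonal products of
    independent centred variables have mean zero. *)
Definition centered_form s (Q : I -> I -> R) l w : R :=
  quad_form s Q (fun j => Y j w) - lin_form s (fun j => Q j j) m2
    + lin_form s l (fun j => Y j w).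

Lemma measurable_centered_form s Q l : measurable_fun setT (centered_form s Q l).
Proof.
have [mY _] := indY.
apply: measurable_funD; last exact: measurable_lin_form.
by apply: measurable_funB => //; exact: measurable_quad_form.
Qed.

(* Integrating out the coordinate [i] adds to the form on [s] a multiple of the
   square of the row of [i]; by a Schur complement argument this keeps the
   two-sided operator bound [nu], while the Hilbert-Schmidt norm drops by what
   the new centering terms cost. *)
Lemma centered_form_mgf s Q l : uniq s -> (forall j k, Q j k = Q k j) ->
  form_le nu s Q ->
  (\int[P]_w (expR (centered_form s Q l w))%:E <=
    (expR (16 * D * hs_sqr s Q + 2 * D * sum_sqr s l))%:E)%E.
Proof.
elim: s Q => [|i s IH] Q.
  move=> _ _ _; under eq_integral do
    rewrite /centered_form /lin_form /quad_form !big_nil subr0 addr0 expR0.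
  rewrite integral_cst//= probability_setT mule1 lee_fin -[leLHS]expR0 ler_expR.
  by rewrite /hs_sqr /sum_sqr !big_nil !mulr0 addr0.
move=> /andP[is_ us] Qsym Qnu.
have [mY _] := indY.
pose c w := centered_form s Q l w.
pose b w := 2 * lin_form s (Q i) (fun j => Y j w) + l i.
have mYs j : j \in s ->
    measurable_fun setT (Y j : g_sigma_algebraType (cylinders _ Y s) -> R).
  exact: measurable_cylinder_coord.
have E1 w : centered_form (i :: s) Q l w =
    Q i i * (Y i w ^+ 2 - m2 i) + b w * Y i w + c w.
  by rewrite /c /centered_form quad_form_cons// /b /lin_form !big_cons; ring.
under eq_integral do rewrite E1.
apply: (le_trans (@integrate_out _ _ _ P _ Y indY i s D nu (m2 i) (Q i i) b c _ _ _ _ _)).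
- by [].
- apply: measurable_funD => //; apply: measurable_funM => //.
  exact: measurable_lin_form.
- apply: measurable_funD; last exact: measurable_lin_form.
  by apply: measurable_funB => //; exact: measurable_quad_form.
- exact: mgfY.
- exact: (form_le_diag _ _ _ _ is_ Qsym Qnu).
(* With $x$ the row form, $D(2x + l_i)^2 \le 8D x^2 + 2D l_i^2$, whence the coefficient $8D$. The
   term $8DS$ of [K] pays for recentring the new diagonal, as [m2] is at most 1. *)
pose Q' := rank1_update (8 * D) (Q i) Q.
pose S := sum_sqr s (Q i).
pose K := D * Q i i ^+ 2 + 2 * D * l i ^+ 2 + 8 * D * S.
have D8 : 0 <= 8 * D by rewrite mulr_ge0// ltW.
have D8nu : 8 * D * nu <= 2^-1 by have := Dnu; lra.
have le1 w : D * (Q i i ^+ 2 + b w ^+ 2) + c w <= K + centered_form s Q' l w.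
  rewrite /c /b /centered_form quad_form_rank1 /K.
  have -> : lin_form s (fun j => Q' j j) m2 =
      lin_form s (fun j => Q j j) m2 + 8 * D * lin_form s (fun j => Q i j ^+ 2) m2.
    rewrite /lin_form mulr_sumr -big_split /=; apply: eq_bigr => j _.
    by rewrite /Q' /rank1_update; ring.
  have : lin_form s (fun j => Q i j ^+ 2) m2 <= S.
    by apply: ler_sum => j _; rewrite ler_piMr// sqr_ge0.
  move: (lin_form s (Q i) _) (lin_form s (fun j => Q i j ^+ 2) m2) => x y yS.
  have h1 : 8 * D * y <= 8 * D * S by rewrite ler_wpM2l.
  have h2 : D * (2 * x + l i) ^+ 2 <= D * (8 * x ^+ 2 + 2 * l i ^+ 2).
    by rewrite ler_pM2l//; have := sqr_ge0 (2 * x - l i); nra.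
  lra.
have mQ' : measurable_fun setT (centered_form s Q' l) by exact: measurable_centered_form.
apply: (@le_trans _ _ (\int[P]_w ((expR K)%:E * (expR (centered_form s Q' l w))%:E))%E).
  apply: ge0_le_integral => //.
  - apply/measurable_EFinP; apply: measurableT_comp => //.
    apply: measurable_funD; last exact: measurable_centered_form.
    apply: measurable_funM => //; apply: measurable_funD => //.
    apply: measurable_funX; apply: measurable_funD => //; apply: measurable_funM => //.
    exact: measurable_lin_form.
  - by apply: measurable_funeM; apply/measurable_EFinP; exact: measurableT_comp.
  - by move=> w _; rewrite -EFinM -expRD lee_fin ler_expR.
rewrite ge0_integralZl ?lee_fin ?expR_ge0//; last first.
  by apply/measurable_EFinP; exact: measurableT_comp.
have sym' j k : Q' j k = Q' k j.
  by rewrite /Q' /rank1_update Qsym [Q i j * _]mulrC.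
have IHQ := IH Q' us sym' (form_le_rank1 _ _ _ _ is_ Qsym Qnu _ D8 D8nu).
apply: (@le_trans _ _ ((expR K)%:E *
    (expR (16 * D * hs_sqr s Q' + 2 * D * sum_sqr s l))%:E)%E).
  by rewrite lee_wpmul2l// lee_fin expR_ge0.
rewrite -EFinM -expRD lee_fin ler_expR /K.
(* The drop of the Hilbert-Schmidt term, $16D(Q_{ii}^2 + \frac23 S)$, covers the part $D Q_{ii}^2 +
   8DS$ of [K]; the part $2D l_i^2$ goes into the linear term. *)
have h := @hs_sqr_rank1_le _ _ nu i s Q is_ Qsym nu0 Qnu (8 * D) D8 D8nu.
have S0 : 0 <= S := sum_sqr_ge0 s (Q i).
have h' := ler_wpM2l (ltW (mulr_gt0 (ltr0Sn R 15) D0)) h.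
have DS : 0 <= D * S by rewrite mulr_ge0// ltW.
have DQ : 0 <= D * Q i i ^+ 2 by rewrite mulr_ge0// ?sqr_ge0// ltW.
rewrite [sum_sqr (i :: s) l]/sum_sqr big_cons -/(sum_sqr s l).
rewrite -/S -/Q' in h'.
lra.
Qed.

End mgf.

(** * From a local sub-Gaussian moment bound to mean zero and two-sided tails *)

Section chernoff.
Context {dsp : measure_display} {T : measurableType dsp} {R : realType}.
Variables (P : probability T R) (W : T -> R) (u0 v : R).
Hypotheses (mW : measurable_fun setT W) (u00 : 0 < u0) (v0 : 0 <= v)
  (mgfW : forall u : R, `|u| <= u0 ->
    (\int[P]_w (expR (u * W w))%:E <= (expR (u ^+ 2 * v))%:E)%E).

Let measurable_expR_W u : measurable_fun setT (fun w => expR (u * W w)).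
Proof. by apply: measurableT_comp => //; exact: measurable_funM. Qed.

Let integrable_expR_W u : `|u| <= u0 ->
  P.-integrable setT (fun w => (expR (u * W w))%:E).
Proof.
move=> uu0; apply/integrableP; split; first exact/measurable_EFinP.
apply: le_lt_trans (ltry (expR (u ^+ 2 * v))).
apply: le_trans (mgfW _ uu0); rewrite le_eqVlt; apply/orP; left; apply/eqP.
by apply: eq_integral => w _; rewrite gee0_abs// lee_fin expR_ge0.
Qed.

Lemma mgf_integrable : P.-integrable setT (EFin \o W).
Proof.
have h1 : P.-integrable setT (fun w => (expR (u0 * W w))%:E).
  by apply: integrable_expR_W; rewrite gtr0_norm.
have h2 : P.-integrable setT (fun w => (expR (- u0 * W w))%:E).
  by apply: integrable_expR_W; rewrite normrN gtr0_norm.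
have h := integrableZl measurableT u0^-1 (integrableD measurableT h1 h2).
apply: le_integrable h => //; first exact/measurable_EFinP.
move=> w _ /=; rewrite lee_fin.
apply: le_trans (ler_norm _); rewrite mulrC ler_pdivlMr//.
rewrite mulNr -[X in _ * X](gtr0_norm u00) -normrM mulrC.
have := expR_ge1Dx (u0 * W w); have := expR_ge1Dx (- (u0 * W w)).
have := expR_gt0 (u0 * W w); have := expR_gt0 (- (u0 * W w)).
move: (u0 * W w) => x; rewrite ler_norml => *; apply/andP; split; lra.
Qed.

(** $u\,E W \le E e^{uW} - 1 \le e^{u^2 v} - 1$, and $e^x - 1 \le x + 2x^2 \le 2x$ for $0 \le x \le
    1/2$. *)
Lemma mgf_mean_le (u : R) : `|u| <= u0 -> u ^+ 2 * v <= 2^-1 ->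
  u * fine (\int[P]_w (W w)%:E) <= 2 * (u ^+ 2 * v).
Proof.
move=> uu0 uv.
have iW := mgf_integrable.
have fW : (\int[P]_w (W w)%:E)%E \is a fin_num by exact: integrable_fin_num.
rewrite -lee_fin EFinM fineK// -integralZl//.
have i1 : P.-integrable setT (cst 1%:E) by exact: finite_measure_integrable_cst.
have iE := integrableB measurableT (integrable_expR_W _ uu0) i1.
apply: (@le_trans _ _ (\int[P]_w ((fun w => (expR (u * W w))%:E) \- cst 1%:E) w)%E).
  apply: le_integral => //.
    exact: (integrableZl measurableT u iW).
  by move=> w _; rewrite /= -EFinM -EFinB lee_fin; have := expR_ge1Dx (u * W w); lra.
rewrite integralB//; last exact: integrable_expR_W.
rewrite integral_cst//= probability_setT mule1 leeBlDr//.
apply: (le_trans (mgfW _ uu0)); rewrite -EFinD lee_fin.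
have := expR_le_quad _ uv; have : 0 <= u ^+ 2 * v by rewrite mulr_ge0// sqr_ge0.
move: (u ^+ 2 * v) uv => x x2 x0; nra.
Qed.

(* The bound [exp (v u^2)] is flat to first order at 0, so [W] is centred. *)
Lemma mgf_mean0 : (\int[P]_w (W w)%:E = 0)%E.
Proof.
have fW : (\int[P]_w (W w)%:E)%E \is a fin_num.
  by apply: integrable_fin_num => //; exact: mgf_integrable.
rewrite -(fineK fW); congr EFin.
set e := fine _.
have key u : 0 < u -> u <= u0 -> u ^+ 2 * v <= 2^-1 -> `|e| <= 2 * u * v.
  move=> p0 pu pv.
  have a1 : `|u| <= u0 by rewrite gtr0_norm.
  have h1 : u * e <= 2 * (u ^+ 2 * v) by exact: mgf_mean_le.
  have h2 : - u * e <= 2 * ((- u) ^+ 2 * v).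
    by apply: mgf_mean_le; rewrite ?normrN ?sqrrN.
  move: (e) h1 h2 => x h1 h2.
  by rewrite ler_norml; apply/andP; split; rewrite -(ler_pM2l p0); lra.
apply/eqP; rewrite -normr_le0; apply/ler_addgt0Pl => eps eps0; rewrite addr0.
(* The three terms ensure $u \le u_0$, $2uv \le \varepsilon$ and $u^2 v \le 1/2$; writing $1+v$
   keeps the denominators positive when $v = 0$. *)
pose u := Num.min u0 (Num.min (eps / (2 * (1 + v))) (2 * (1 + v))^-1).
have v1 : 0 < 2 * (1 + v) by have := v0; lra.
have up : 0 < u by rewrite /u !lt_min u00 divr_gt0//= invr_gt0.
have uu : u <= u0 by rewrite /u ge_min lexx.
have ue : u * (2 * (1 + v)) <= eps.
  by rewrite -ler_pdivlMr// /u !ge_min lexx orbT.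
have u1 : u * (2 * (1 + v)) <= 1.
  by rewrite -ler_pdivlMr// div1r /u !ge_min lexx !orbT.
have vv := v0.
apply: (le_trans (key u up uu _)); last by nra.
have : u * v <= 2^-1 by nra.
have : u <= 1 by nra.
rewrite expr2 -mulrA => h3 h4.
by apply: le_trans h4; rewrite ler_piMl// mulr_ge0// ltW.
Qed.

Let measurable_tail (g t : R) : measurable [set w | t <= g * W w].
Proof.
rewrite -[X in measurable X]setTI.
have mgW : measurable_fun setT (fun w => g * W w) by exact: measurable_funM.
rewrite (_ : [set w | _] = (fun w => g * W w) @^-1` `[t, +oo[); first exact: mgW.
by apply/seteqP; split => w /=; rewrite in_itv/= andbT.
Qed.

Let upper_tail (g : R) (t : R) : g ^+ 2 = 1 -> 0 <= t ->
  (P [set w | (t <= g * W w)%R] <=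
   (expR (- (2^-1 * Num.min (t ^+ 2 / (2 * v)) (u0 * t))))%:E)%E.
Proof.
move=> g1 t0.
(* The minimiser $t/(2v)$ of $u^2 v - ut$, capped at [u0]; either way $u^2 v \le ut/2$. If $v = 0$
   the quotient is 0 by convention, so $u = 0$ and the bound is the trivial one. The sign [g] treats
   both tails at once. *)
pose u := Num.min (t / (2 * v)) u0.
have vv := v0; have uu := u00.
have ge0u : 0 <= u by rewrite /u le_min (ltW u00) andbT divr_ge0// mulr_ge0.
have leu : u <= u0 by rewrite /u ge_min lexx orbT.
have ng : `|g| = 1.
  by apply/eqP; rewrite -(@eqrXn2 _ 2)// real_normK ?num_real// g1 expr1n.
have uv : u ^+ 2 * v <= 2^-1 * (u * t).
  have [->|vn] := eqVneq v 0; first by rewrite mulr0 mulr_ge0// mulr_ge0.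
  have v2 : 0 < 2 * v by rewrite mulr_gt0// lt_neqAle eq_sym vn.
  have : u * (2 * v) <= t by rewrite -ler_pdivlMr// /u ge_min lexx.
  move=> h; have := ler_wpM2l ge0u h; rewrite expr2; lra.
have -> : Num.min (t ^+ 2 / (2 * v)) (u0 * t) = u * t.
  by rewrite /u minr_pMl// expr2 mulrAC.
have ug : `|u * g| <= u0 by rewrite normrM ng mulr1 ger0_norm.
have -> : P [set w | t <= g * W w] =
    (\int[P]_w (\1_[set w | (t <= g * W w)%R] w)%:E)%E.
  by rewrite integral_indic// setIT.
apply: (@le_trans _ _ (\int[P]_w ((expR (- (u * t)))%:E * (expR (u * g * W w))%:E))%E).
  apply: ge0_le_integral => //.
  - by apply/measurable_EFinP; exact: measurable_indic.
  - by apply: measurable_funeM; exact/measurable_EFinP.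
  move=> w _; rewrite -EFinM -expRD lee_fin indicE.
  case: (boolP (w \in _)) => [|_]; last exact: expR_ge0.
  rewrite inE /= => tw; rewrite -[leLHS]expR0 ler_expR.
  by have := ler_wpM2l ge0u tw; rewrite mulrA; lra.
rewrite ge0_integralZl ?lee_fin ?expR_ge0//; last exact/measurable_EFinP.
apply: (@le_trans _ _ ((expR (- (u * t)))%:E * (expR ((u * g) ^+ 2 * v))%:E)%E).
  by rewrite lee_wpmul2l ?lee_fin ?expR_ge0//; exact: mgfW.
rewrite -EFinM -expRD lee_fin ler_expR exprMn g1 mulr1; lra.
Qed.

Lemma chernoff_two_sided (t : R) : 0 <= t ->
  (P [set w | (t <= `|W w|)%R] <=
   (2 * expR (- (2^-1 * Num.min (t ^+ 2 / (2 * v)) (u0 * t))))%:E)%E.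
Proof.
move=> t0.
have -> : [set w | t <= `|W w|] = [set w | t <= 1 * W w] `|` [set w | t <= -1 * W w].
  apply/seteqP; split => w /=; rewrite mul1r mulN1r ler_normr.
    by move=> /orP.
  by move=> tw; apply/orP.
apply: (le_trans (measureU2 _ _ _)) => //.
rewrite mulr_natl mulr2n EFinD; apply: leeD; apply: upper_tail => //.
  by rewrite expr1n.
by rewrite sqrrN expr1n.
Qed.

End chernoff.

(** * Sub-Gaussian scales: centring and normalisation *)

Section scales.
Context {dsp : measure_display} {T : measurableType dsp} {R : realType}.
Variable P : probability T R.

Lemma psi2_scalesP (Y : T -> R) (s : R) : psi2_scales P Y s ->
  0 < s /\ (\int[P]_w (expR ((Y w / s) ^+ 2))%:E <= 2%:E)%E.
Proof.
move=> [s0]; rewrite unlock => h; split => //; apply: le_trans h.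
rewrite le_eqVlt; apply/orP; left; apply/eqP; apply: eq_integral => w _.
by rewrite expr_div_n.
Qed.

(** $(Y-m)^2 \le 2Y^2 + 2m^2$, and enlarging the scale by [r] multiplies the exponent by a small
    [th]; convexity then gives the bound $e^{\theta a}(1+\theta)$ with $a = (m/s_0)^2$, which is
    below 2. *)
Lemma subgaussian_shift (Y : T -> R) (m : R) : measurable_fun setT Y ->
  subgaussian P Y -> subgaussian P (fun w => Y w - m).
Proof.
move=> mY [s0 /psi2_scalesP[s0_gt0 expY]].
pose a := (m / s0) ^+ 2; have a0 : 0 <= a := sqr_ge0 _.
pose r := 4 * (1 + a); have r4 : 4 <= r by rewrite /r; lra.
have r0 : 0 < r by lra.
pose th := 2 / r ^+ 2; have th0 : 0 < th by rewrite divr_gt0// exprn_gt0.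
have thE : th * r ^+ 2 = 2 by rewrite /th divfK// expf_neq0// gt_eqF.
have th8 : th * (8 * (1 + a)) <= 1 by move: thE; rewrite /r; nra.
have tha0 : 0 <= th * a by rewrite mulr_ge0// ltW.
exists (s0 * r); split; first by rewrite mulr_gt0.
have mf : measurable_fun setT (fun w => expR ((Y w - m) ^+ 2 / (s0 * r) ^+ 2)).
  apply: measurableT_comp => //; apply: measurable_funM => //.
  by apply: measurable_funX; exact: measurable_funB.
rewrite unlock.
apply: (@le_trans _ _ (expR (th * a) * (1 - th) + (expR (th * a) * th) * 2)%:E).
  apply: (@integral_le_affine_exp _ _ _ _ (fun w => Y w / s0)) => //.
  - exact: measurable_funM.
  - by rewrite mulr_ge0 ?expR_ge0// ltW.
  move=> w; rewrite -mulrA -mulrDr.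
  apply: (@le_trans _ _ (expR (th * a) * expR (th * (Y w / s0) ^+ 2))); last first.
    rewrite ler_wpM2l ?expR_ge0//; apply: expR_convex; apply/andP; split; nra.
  have -> : (Y w - m) ^+ 2 / (s0 * r) ^+ 2 =
      th * (2^-1 * (Y w / s0 - m / s0) ^+ 2).
    by rewrite /th -mulrBl; field; rewrite !gt_eqF.
  rewrite -expRD ler_expR -mulrDr ler_wpM2l ?(ltW th0)// /a.
  by have := sqr_ge0 (Y w / s0 + m / s0); nra.
rewrite lee_fin.
have x2 : th * a <= 2^-1 by nra.
have e := expR_le_quad _ x2.
have e1 : expR (th * a) <= 11 / 8 by nra.
have := expR_gt0 (th * a); nra.
Qed.

(** Strictly above the infimum there is an admissible scale below [K], whether or not the infimum is
    attained; hence the normalisation by [2 * kappa] later on. *)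
Lemma psi2_norm_lt_scale (Y : T -> R) (K : R) : measurable_fun setT Y ->
  subgaussian P Y -> psi2_norm P Y < K ->
  (\int[P]_w (expR ((Y w / K) ^+ 2))%:E <= 2%:E)%E.
Proof.
move=> mY sY /inf_lt -/(_ sY)[s /psi2_scalesP[s0 expY] sK].
apply: le_trans expY; apply: ge0_le_integral => //.
- apply/measurable_EFinP; apply: measurableT_comp => //.
  by apply: measurable_funX; exact: measurable_funM.
- apply/measurable_EFinP; apply: measurableT_comp => //.
  by apply: measurable_funX; exact: measurable_funM.
move=> w _; rewrite lee_fin ler_expR !exprMn ler_wpM2l ?sqr_ge0//.
by rewrite ler_sqr ?nnegrE ?invr_ge0 ?lef_pV2 ?posrE// ?ltW// (lt_trans s0).
Qed.

Lemma subgaussian_integrable (Y : T -> R) : measurable_fun setT Y ->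
  subgaussian P Y -> P.-integrable setT (EFin \o Y).
Proof.
move=> mY [s /psi2_scalesP[s0 expY]].
have mYs : measurable_fun setT (fun w => Y w / s) by exact: measurable_funM.
have := integrableZl measurableT s (integrable_subgaussian P _ mYs expY).
apply: eq_integrable => // w _ /=; rewrite -EFinM; congr EFin.
by rewrite mulrC divfK// gt_eqF.
Qed.

Lemma integral_centered (Y : T -> R) (K : R) : measurable_fun setT Y ->
  subgaussian P Y -> (\int[P]_w ((Y w - Ef P Y) / K)%:E = 0)%E.
Proof.
move=> mY sY; have iY := subgaussian_integrable _ mY sY.
have im : P.-integrable setT (cst (Ef P Y)%:E) by exact: finite_measure_integrable_cst.
transitivity (\int[P]_w (K^-1%:E * ((EFin \o Y) \- cst (Ef P Y)%:E) w))%E.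
  by apply: eq_integral => w _; rewrite /= -EFinB -EFinM mulrC.
rewrite integralZl//; last exact: integrableB.
rewrite integralB// integral_cst//= probability_setT mule1.
rewrite /Ef unlock fineK; first by rewrite subee ?mule0// integrable_fin_num.
exact: integrable_fin_num.
Qed.

Lemma mutually_independent_comp (I : finType) (Y : I -> T -> R)
    (f : I -> R -> R) : (forall i, measurable_fun setT (f i)) ->
  mutually_independent P Y -> mutually_independent P (fun i => f i \o Y i).
Proof.
move=> mf [mY indY]; split=> [i|J B mB]; first exact: measurableT_comp.
apply: (indY J (fun i => f i @^-1` B i)) => i.
by rewrite -[X in measurable X]setTI; exact: mf.
Qed.

End scales.

(** * Symmetric part, Frobenius norm and spectral norm *)

Section matrices.
Context {R : realType} {n : nat}.
Implicit Types (A : 'M[R]_n) (x : 'cV[R]_n).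

Definition sym_part A : 'M[R]_n := 2^-1 *: (A + A^T).

Lemma sym_partE A i j : sym_part A i j = 2^-1 * (A i j + A j i).
Proof. by rewrite !mxE. Qed.

Lemma sym_part_sym A i j : sym_part A i j = sym_part A j i.
Proof. by rewrite !sym_partE addrC. Qed.

Lemma sum_sym_part A (g : 'I_n -> 'I_n -> R) : (forall i j, g i j = g j i) ->
  \sum_i \sum_j A i j * g i j = \sum_i \sum_j sym_part A i j * g i j.
Proof.
move=> gsym.
have e : \sum_i \sum_j A j i * g i j = \sum_i \sum_j A i j * g i j.
  by rewrite exchange_big; apply: eq_bigr => i _; apply: eq_bigr => j _; rewrite gsym.
under [RHS]eq_bigr => i _ do under eq_bigr => j _ do
  rewrite sym_partE -mulrA mulrDl mulrDr.
under [RHS]eq_bigr do rewrite big_split -!mulr_sumr.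
by rewrite big_split -!mulr_sumr /= e; lra.
Qed.

Lemma frob2_sym_part A : frob2 (sym_part A) <= frob2 A.
Proof.
have e : \sum_i \sum_j A j i ^+ 2 = frob2 A by rewrite exchange_big.
have -> : frob2 A = \sum_i \sum_j 2^-1 * (A i j ^+ 2 + A j i ^+ 2).
  under eq_bigr do rewrite -mulr_sumr big_split.
  by rewrite -mulr_sumr big_split /= e -/(frob2 A); lra.
apply: ler_sum => i _; apply: ler_sum => j _; rewrite sym_partE.
by have := sqr_ge0 (A i j - A j i); nra.
Qed.

Lemma frob2_ge0 m p (B : 'M[R]_(m, p)) : 0 <= frob2 B.
Proof. by apply: sumr_ge0 => i _; apply: sumr_ge0 => j _; exact: sqr_ge0. Qed.

Lemma eucl_sqr p (x : 'cV[R]_p) : eucl x ^+ 2 = \sum_i x i ord0 ^+ 2.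
Proof. by rewrite sqr_sqrtr// sumr_ge0// => i _; exact: sqr_ge0. Qed.

Lemma eucl_ge0 p (x : 'cV[R]_p) : 0 <= eucl x.
Proof. exact: sqrtr_ge0. Qed.

Lemma euclZ p (a : R) (x : 'cV[R]_p) : 0 <= a -> eucl (a *: x) = a * eucl x.
Proof.
move=> a0; rewrite /eucl -[a in RHS]ger0_norm// -sqrtr_sqr -sqrtrM ?sqr_ge0//.
by rewrite mulr_sumr; congr Num.sqrt; apply: eq_bigr => i _; rewrite mxE exprMn.
Qed.

(* [sup] of an unbounded set is 0, so a positive [spec_norm A] is a genuine bound. *)
Lemma spec_norm_bound A x : 0 < spec_norm A -> eucl (A *m x) <= spec_norm A * eucl x.
Proof.
move=> A0; have hs : has_sup [set eucl (A *m x) | x in [set x : 'cV[R]_n | eucl x = 1]].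
  by apply: contrapT => /sup_out; rewrite -/(spec_norm A) => A00; rewrite A00 ltxx in A0.
have [x0|x0] := eqVneq (eucl x) 0.
  suff -> : x = 0.
    rewrite mulmx0 /eucl big1 ?sqrtr0 ?mulr_ge0 ?sqrtr_ge0 ?(ltW A0)// => i _.
    by rewrite mxE expr0n.
  have : \sum_i x i ord0 ^+ 2 = 0 by rewrite -eucl_sqr x0 expr0n.
  move=> /eqP; rewrite psumr_eq0 => [|i _]; last exact: sqr_ge0.
  move=> /allP h; apply/matrixP => i j; rewrite mxE (ord1 j).
  by apply/eqP; have := h i (mem_index_enum _); rewrite /= sqrf_eq0.
have xp : 0 < eucl x by rewrite lt_neqAle eq_sym x0 eucl_ge0.
rewrite -ler_pdivrMr// mulrC -euclZ ?invr_ge0 ?(ltW xp)// scalemxAr.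
apply: (ub_le_sup (proj2 hs)); exists ((eucl x)^-1 *: x) => //=.
by rewrite euclZ ?invr_ge0 ?(ltW xp)// mulVf.
Qed.

(** Cauchy-Schwarz in expanded form: with $\sigma$ the spectral norm, $y = Ax$ and $g = \pm1$, the
    sum of $(\sigma x_i - g y_i)^2$ is nonnegative and $\|y\| \le \sigma\|x\|$. *)
Lemma spec_norm_form A (x : 'I_n -> R) : 0 < spec_norm A ->
  `|\sum_i \sum_j A i j * (x i * x j)| <= spec_norm A * \sum_i x i ^+ 2.
Proof.
move=> A0; pose v := \col_i x i; pose y := A *m v.
have v2 : eucl v ^+ 2 = \sum_i x i ^+ 2.
  by rewrite eucl_sqr; apply: eq_bigr => i _; rewrite mxE.
have y2 : \sum_i y i ord0 ^+ 2 <= spec_norm A ^+ 2 * \sum_i x i ^+ 2.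
  rewrite -eucl_sqr -v2 -exprMn ler_sqr ?nnegrE ?eucl_ge0 ?mulr_ge0 ?eucl_ge0 ?(ltW A0)//.
  exact: spec_norm_bound.
have -> : \sum_i \sum_j A i j * (x i * x j) = \sum_i x i * y i ord0.
  apply: eq_bigr => i _; rewrite mxE mulr_sumr; apply: eq_bigr => j _.
  by rewrite mxE; ring.
have key (g : R) : g ^+ 2 = 1 ->
    g * (\sum_i x i * y i ord0) <= spec_norm A * \sum_i x i ^+ 2.
  move=> g1; rewrite -(ler_pM2l (mulr_gt0 (ltr0Sn R 1) A0)).
  have : 0 <= \sum_i (spec_norm A * x i - g * y i ord0) ^+ 2.
    by apply: sumr_ge0 => i _; exact: sqr_ge0.
  have -> : \sum_i (spec_norm A * x i - g * y i ord0) ^+ 2 =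
      spec_norm A ^+ 2 * (\sum_i x i ^+ 2) + \sum_i y i ord0 ^+ 2
      - 2 * spec_norm A * g * (\sum_i x i * y i ord0).
    rewrite !mulr_sumr -big_split -sumrB /=; apply: eq_bigr => i _.
    rewrite sqrrB !exprMn g1 mul1r mulr2n; ring.
  rewrite expr2; lra.
rewrite ler_norml lerNl -mulN1r -[X in _ && (X <= _)]mul1r.
by rewrite !key ?sqrrN ?expr1n.
Qed.

End matrices.

(** * The Gram sum as a quadratic form of matrix $A^{\mathsf S} \otimes I_d$ *)

Section kronecker_form.
Context {R : realType} {n d : nat}.
Implicit Types (B : 'M[R]_n) (x : 'I_n * 'I_d -> R).

Definition kron_id B (p q : 'I_n * 'I_d) : R := (p.2 == q.2)%:R * B p.1 q.1.

Lemma sum_delta (k : 'I_d) (F : 'I_d -> R) : \sum_l (k == l)%:R * F l = F k.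
Proof.
rewrite (bigD1 k)//= eqxx mul1r big1 ?addr0// => l; rewrite eq_sym => /negbTE->.
by rewrite mul0r.
Qed.

Lemma sum_pair (F : 'I_n * 'I_d -> R) : \sum_p F p = \sum_k \sum_i F (i, k).
Proof. by rewrite exchange_big pair_bigA; apply: eq_bigr => -[i k]. Qed.

Lemma quad_form_kron B x : quad_form (index_enum _) (kron_id B) x =
  \sum_k \sum_i \sum_j B i j * (x (i, k) * x (j, k)).
Proof.
rewrite /quad_form sum_pair; apply: eq_bigr => k _; apply: eq_bigr => i _.
rewrite sum_pair exchange_big; apply: eq_bigr => j _ /=.
rewrite -[RHS](sum_delta k (fun l => B i j * (x (i, k) * x (j, l)))).
by apply: eq_bigr => l _; rewrite /kron_id /=; ring.
Qed.

(** The matrix consists of [d] diagonal copies of [B]; this is the origin of the factor $d$ before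
    $\|A\|_F^2$. *)
Lemma hs_sqr_kron B : hs_sqr (index_enum _) (kron_id B) = d%:R * frob2 B.
Proof.
rewrite mulr_natl -[d in RHS]card_ord -sumr_const.
rewrite /hs_sqr sum_pair; apply: eq_bigr => k _; apply: eq_bigr => i _.
rewrite sum_pair exchange_big; apply: eq_bigr => j _ /=.
rewrite -[RHS](sum_delta k (fun=> B i j ^+ 2)).
apply: eq_bigr => l _; rewrite /kron_id /= exprMn.
by case: (k == l); rewrite ?expr1n ?expr0n.
Qed.

(** The form splits over the [d] coordinates, and on each of them [A] and its symmetric part define
    the same form, so [spec_norm A] itself serves as the bound. *)
Lemma kron_form_le (A : 'M[R]_n) (nu u : R) : 0 < spec_norm A ->
  `|u| * spec_norm A <= nu ->
  form_le nu (index_enum _) (fun p q => u * kron_id (sym_part A) p q).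
Proof.
move=> A0 unu x.
have -> : quad_form (index_enum _) (fun p q => u * kron_id (sym_part A) p q) x =
    u * quad_form (index_enum _) (kron_id (sym_part A)) x.
  rewrite /quad_form mulr_sumr; apply: eq_bigr => p _; rewrite mulr_sumr.
  by apply: eq_bigr => q _; rewrite !mulrA.
have sE : sum_sqr (index_enum _) x = \sum_k \sum_i x (i, k) ^+ 2.
  exact: sum_pair.
have S0 := sum_sqr_ge0 (index_enum _) x.
rewrite normrM; apply: (@le_trans _ _ (`|u| * (spec_norm A * sum_sqr (index_enum _) x))).
  rewrite ler_wpM2l// quad_form_kron sE mulr_sumr.
  apply: (le_trans (ler_norm_sum _ _ _)); apply: ler_sum => k _.
  rewrite -(sum_sym_part A (fun i j => x (i, k) * x (j, k))); last by move=> i j; rewrite mulrC.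
  exact: (spec_norm_form A (fun i => x (i, k))).
by rewrite mulrA ler_wpM2r.
Qed.

(** Expansion of $X = m + Kx$: by symmetry of $A^{\mathsf S}$ the two cross terms coincide, which
    gives the 2 in the linear coefficients $2/K$. *)
Lemma gram_decomp (A : 'M[R]_n) (m : 'M[R]_(d, n)) (K : R) x : K != 0 ->
  \sum_i \sum_j A i j * (\sum_k (m k i + K * x (i, k)) * (m k j + K * x (j, k))) =
  (\sum_i \sum_j A i j * (\sum_k m k i * m k j)) +
  K ^+ 2 * (quad_form (index_enum _) (kron_id (sym_part A)) x +
    lin_form (index_enum _) (fun p => 2 / K * (m *m sym_part A) p.2 p.1) x).
Proof.
move=> K0.
rewrite (sum_sym_part A (fun i j => \sum_k (m k i + K * x (i, k)) * (m k j + K * x (j, k))));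
  last by move=> i j; apply: eq_bigr => k _; rewrite mulrC.
rewrite (sum_sym_part A (fun i j => \sum_k m k i * m k j));
  last by move=> i j; apply: eq_bigr => k _; rewrite mulrC.
have swap (F : 'I_n -> 'I_n -> 'I_d -> R) :
    \sum_i \sum_j sym_part A i j * (\sum_k F i j k) =
    \sum_k \sum_i \sum_j sym_part A i j * F i j k.
  under eq_bigr => i _ do (under eq_bigr do rewrite mulr_sumr; rewrite exchange_big).
  by rewrite exchange_big.
rewrite !swap quad_form_kron.
have -> : lin_form (index_enum _) (fun p => 2 / K * (m *m sym_part A) p.2 p.1) x =
    \sum_k \sum_i \sum_j 2 / K * (sym_part A i j * (m k i * x (j, k))).
  rewrite /lin_form sum_pair; apply: eq_bigr => k _.
  rewrite [RHS]exchange_big; apply: eq_bigr => j _ /=.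
  rewrite mxE mulr_sumr mulr_suml; apply: eq_bigr => i _; ring.
rewrite mulrDr !mulr_sumr -!big_split /=; apply: eq_bigr => k _.
have e : \sum_i \sum_j sym_part A i j * (x (i, k) * m k j) =
    \sum_i \sum_j sym_part A i j * (m k i * x (j, k)).
  rewrite exchange_big; apply: eq_bigr => i _; apply: eq_bigr => j _.
  by rewrite sym_part_sym [x _ * _]mulrC.
have e2 : \sum_i \sum_j K * (sym_part A i j * (m k i * x (j, k))) =
    \sum_i \sum_j K * (sym_part A i j * (x (i, k) * m k j)).
  under eq_bigr do rewrite -mulr_sumr.
  under [RHS]eq_bigr do rewrite -mulr_sumr.
  by rewrite -!mulr_sumr e.
apply: (@eq_trans _ _ (\sum_i \sum_j sym_part A i j * (m k i * m k j) +
  (K ^+ 2 * (\sum_i \sum_j sym_part A i j * (x (i, k) * x (j, k))) +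
   (\sum_i \sum_j K * (sym_part A i j * (m k i * x (j, k))) +
    \sum_i \sum_j K * (sym_part A i j * (x (i, k) * m k j)))))).
  rewrite mulr_sumr -!big_split; apply: eq_bigr => i _ /=.
  rewrite mulr_sumr -!big_split; apply: eq_bigr => j _ /=; ring.
rewrite -e2; congr (_ + (_ + _)).
rewrite mulr_sumr -big_split; apply: eq_bigr => i _ /=.
rewrite mulr_sumr -big_split; apply: eq_bigr => j _ /=.
by field.
Qed.

End kronecker_form.

(** * The moment bound for the normalised coordinates *)

Section hanson_wright.
Context {dsp : measure_display} {T : measurableType dsp} {R : realType}.
Variables (P : probability T R) (n d : nat) (Y : 'I_n * 'I_d -> T -> R).
Hypotheses (indY : mutually_independent P Y)
  (expY : forall p, (\int[P]_w (expR (Y p w ^+ 2))%:E <= 2%:E)%E)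
  (meanY : forall p, (\int[P]_w (Y p w)%:E = 0)%E).

Lemma kron_centered_mgf (A : 'M[R]_n) (l : 'I_n * 'I_d -> R) (D u : R) :
  D = 512 * expR 1 -> 0 < spec_norm A -> `|u| <= (16 * D * spec_norm A)^-1 ->
  (\int[P]_w (expR (u * centered_form _ Y (fun p => Ef P (fun w => Y p w ^+ 2))
      (index_enum _) (kron_id (sym_part A)) l w))%:E <=
   (expR (u ^+ 2 * (16 * D * (d%:R * frob2 A) + 2 * D * sum_sqr (index_enum _) l)))%:E)%E.
Proof.
move=> DE A0 uA.
have [mY _] := indY.
have e1 : 1 <= expR 1 :> R by rewrite -expR0 ler_expR.
have D512 : 512 <= D by rewrite DE; lra.
have D0 : 0 < D by lra.
(* The largest value allowed by [16 * D * nu <= 1]; as [D] is at least 512, it lies within the range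
   $1/8$ of [subgaussian_mgf]. *)
pose nu := (16 * D)^-1.
have nu0 : 0 < nu by rewrite invr_gt0 mulr_gt0.
have Dnu : 16 * D * nu <= 1 by rewrite /nu mulfV// gt_eqF// mulr_gt0.
have nu8 : nu <= 8^-1 by rewrite /nu lef_pV2 ?posrE ?mulr_gt0//; lra.
have m1 p : Ef P (fun w => Y p w ^+ 2) <= 1 by exact: second_moment_le1.
have mgfY p x y : `|x| <= nu ->
    (\int[P]_w (expR (x * (Y p w ^+ 2 - Ef P (fun w => Y p w ^+ 2)) + y * Y p w))%:E <=
      (expR (D * (x ^+ 2 + y ^+ 2)))%:E)%E.
  by move=> xnu; rewrite DE; apply: subgaussian_mgf => //; exact: le_trans nu8.
have sym (p q : 'I_n * 'I_d) : u * kron_id (sym_part A) p q = u * kron_id (sym_part A) q p :> R.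
  by rewrite /kron_id eq_sym sym_part_sym.
have fl : form_le nu (index_enum _) (fun p q : 'I_n * 'I_d => u * kron_id (sym_part A) p q).
  by apply: kron_form_le => //; rewrite -ler_pdivlMr// /nu -invfM.
have := @centered_form_mgf _ _ _ P _ Y D nu _ indY D0 nu0 Dnu m1 mgfY (index_enum _) _
  (fun p => u * l p) (index_enum_uniq _) sym fl.
have -> : (fun w => (expR (centered_form _ Y (fun p => Ef P (fun w => Y p w ^+ 2))
      (index_enum _) (fun p q => u * kron_id (sym_part A) p q) (fun p => u * l p) w))%:E) =
   (fun w => (expR (u * centered_form _ Y (fun p => Ef P (fun w => Y p w ^+ 2))
      (index_enum _) (kron_id (sym_part A)) l w))%:E).
  apply/funext => w; congr ((expR _)%:E).
  rewrite /centered_form /quad_form /lin_form mulrDr mulrBr !mulr_sumr.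
  congr (_ - _ + _); apply: eq_bigr => p _; rewrite ?mulrA//.
  by rewrite mulr_sumr; apply: eq_bigr => q _; rewrite !mulrA.
move=> h; apply: (le_trans h); rewrite lee_fin ler_expR.
have -> : hs_sqr (index_enum _) (fun p q : 'I_n * 'I_d => u * kron_id (sym_part A) p q) =
    u ^+ 2 * (d%:R * frob2 (sym_part A)).
  rewrite -hs_sqr_kron /hs_sqr mulr_sumr; apply: eq_bigr => p _.
  by rewrite mulr_sumr; apply: eq_bigr => q _; rewrite exprMn.
have -> : sum_sqr (index_enum _) (fun p => u * l p) = u ^+ 2 * sum_sqr (index_enum _) l.
  by rewrite /sum_sqr mulr_sumr; apply: eq_bigr => p _; rewrite exprMn.
have := ler_wpM2l (ler0n R d) (frob2_sym_part A).
have := sqr_ge0 u; have : 0 <= 16 * D by rewrite mulr_ge0// ltW.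
move: (d%:R * frob2 (sym_part A)) (d%:R * frob2 A) (sum_sqr _ l) => x y z D16 u2 xy.
rewrite mulrDr lerD ?[_ * (u ^+ 2 * _)]mulrCA// ler_wpM2l// ler_wpM2l//.
Qed.

End hanson_wright.

(** * Normalisation, identification of the mean, and constants *)

Theorem theorem6 (R : realType) :
  exists c : R, 0 < c /\
  forall (dsp : measure_display) (T : measurableType dsp) (P : probability T R)
    (n d : nat) (X : 'I_n -> 'I_d -> T -> R) (A : 'M[R]_n) (t : R),
    mutually_independent P (fun ik : 'I_n * 'I_d => X ik.1 ik.2) ->
    (forall i k, subgaussian P (X i k)) ->
    let M : 'M[R]_(d, n) := \matrix_(k, i) Ef P (X i k) in
    let kappa : R := \big[Num.max/0]_(ik : 'I_n * 'I_d)
        psi2_norm P (fun w => X ik.1 ik.2 w - M ik.2 ik.1) in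
    let AS : 'M[R]_n := 2^-1 *: (A + A^T) in
    let Z : T -> R := fun w =>
        \sum_(i < n) \sum_(j < n) A i j * (\sum_(k < d) X i k w * X j k w) in
    0 < kappa -> 0 <= t ->
    (P [set w | (kappa ^+ 2 * t <= `|Z w - Ef P Z|)%R]
      <= (4 * expR (- c * Num.min
             (t ^+ 2 / (d%:R * frob2 A + kappa ^- 2 * frob2 (M *m AS)))
             (t / spec_norm A)))%:E)%E.
Proof.
have [D DE D0] : exists2 D : R, D = 512 * expR 1 & 0 < D.
  by exists (512 * expR 1) => //; rewrite mulr_gt0 ?expR_gt0 ?ltr0n.
have c0 : 0 < (1024 * D)^-1 by rewrite invr_gt0 mulr_gt0 ?ltr0n.
(* Chernoff at level $t/4$ with variance proxy $16DV$ gives $\frac12 (t/4)^2/(32DV) =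
   t^2/(1024\,DV)$; the linear regime has a factor 8 to spare. *)
exists (1024 * D)^-1; split => //.
move=> dsp T P n d X A t indX sX M kappa AS Z kappa0 t0.
pose V := d%:R * frob2 A + kappa ^- 2 * frob2 (M *m AS).
have V0 : 0 <= V.
  by rewrite addr_ge0// mulr_ge0 ?frob2_ge0// invr_ge0 exprn_ge0// ltW.
rewrite -/V.
have mX i k : measurable_fun setT (X i k) by have [mX _] := indX; exact: (mX (i, k)).
have mZ : measurable_fun setT Z.
  apply: measurable_sum => i; apply: measurable_sum => j.
  apply: measurable_funM => //; apply: measurable_sum => k.
  exact: measurable_funM.
(* If the spectral norm is not positive, the quotient $t/\|A\|$ is at most 0 (division by 0 gives
   0), so the right-hand side is at least 4. *)
have [A0|A0] := lerP (spec_norm A) 0.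
  apply: (@le_trans _ _ 1%E).
    apply: probability_le1.
    have mW : measurable_fun setT (fun w => `|Z w - Ef P Z|).
      by apply: measurableT_comp => //; exact: measurable_funB.
    rewrite -[X in measurable X]setTI.
    rewrite (_ : [set w | _] =
      (fun w => `|Z w - Ef P Z|) @^-1` `[kappa ^+ 2 * t, +oo[); first exact: mW.
    by apply/seteqP; split => w /=; rewrite in_itv/= andbT.
  rewrite lee_fin; apply: (@le_trans _ _ (4 * 1)); first by rewrite mulr1 ler1n.
  rewrite ler_pM2l// -[leLHS]expR0 ler_expR mulNr oppr_ge0.
  rewrite mulr_ge0_le0 ?(ltW c0)// ge_min; apply/orP; right.
  by rewrite mulr_ge0_le0// invr_le0.
pose K := 2 * kappa.
have K0 : 0 < K by rewrite mulr_gt0.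
have Kn : K != 0 by rewrite gt_eqF.
pose Y (p : 'I_n * 'I_d) w := (X p.1 p.2 w - M p.2 p.1) / K.
have mXM p : measurable_fun setT (fun w => X p.1 p.2 w - M p.2 p.1).
  exact: measurable_funB.
have indY : mutually_independent P Y.
  apply: (mutually_independent_comp P _ _ (fun p x => (x - M p.2 p.1) / K) _ indX) => p.
  by apply: measurable_funM => //; exact: measurable_funB.
have expY p : (\int[P]_w (expR (Y p w ^+ 2))%:E <= 2%:E)%E.
  apply: psi2_norm_lt_scale => //; first exact: subgaussian_shift.
  apply: (@le_lt_trans _ _ kappa); last by rewrite /K; lra.
  by rewrite /kappa (bigD1 p)//= le_max lexx.
have meanY p : (\int[P]_w (Y p w)%:E = 0)%E.
  rewrite -(integral_centered P (X p.1 p.2) K)//.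
  by apply: eq_integral => w _; rewrite /Y mxE.
pose l (p : 'I_n * 'I_d) := 2 / K * (M *m AS) p.2 p.1.
pose m2 (p : 'I_n * 'I_d) := Ef P (fun w => Y p w ^+ 2).
pose W := centered_form _ Y m2 (index_enum _) (kron_id AS) l.
(* The constant [e] collects the form in the means and the diagonal centring subtracted in [W]; it
   is recognised as the mean of [Z] once [W] is known to have mean zero. *)
have [e ZW] : exists e, forall w, Z w = e + K ^+ 2 * W w.
  exists (\sum_i \sum_j A i j * (\sum_k M k i * M k j) +
    K ^+ 2 * lin_form (index_enum _) (fun p => kron_id AS p p) m2) => w.
  have -> : Z w = \sum_i \sum_j A i j *
      (\sum_k (M k i + K * Y (i, k) w) * (M k j + K * Y (j, k) w)).
    apply: eq_bigr => i _; apply: eq_bigr => j _; congr (_ * _).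
    apply: eq_bigr => k _.
    by rewrite /Y /= ![K * _]mulrC !divfK// ![M k _ + _]addrC !subrK.
  rewrite (gram_decomp A M K (fun p => Y p w) Kn) -/AS /W /centered_form -/l; ring.
have mW : measurable_fun setT W by exact: (measurable_centered_form P _ Y m2 indY).
have lV : sum_sqr (index_enum _) l = kappa ^- 2 * frob2 (M *m AS).
  rewrite /sum_sqr sum_pair /frob2 mulr_sumr; apply: eq_bigr => k _.
  rewrite mulr_sumr; apply: eq_bigr => i _; rewrite /l /= exprMn.
  by congr (_ * _); rewrite /K; field; rewrite gt_eqF.
pose u0 := (16 * D * spec_norm A)^-1.
have u00 : 0 < u0 by rewrite invr_gt0 !mulr_gt0.
have DV0 : 0 <= 16 * D * V by rewrite mulr_ge0// mulr_ge0// ltW.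
have mgfW u : `|u| <= u0 ->
    (\int[P]_w (expR (u * W w))%:E <= (expR (u ^+ 2 * (16 * D * V)))%:E)%E.
  move=> uu0; apply: (le_trans (kron_centered_mgf P n d Y indY expY meanY A l D u DE A0 uu0)).
  rewrite lee_fin ler_expR ler_wpM2l ?sqr_ge0// lV /V [16 * D * (_ + _)]mulrDr lerD2l.
  rewrite ler_wpM2r ?mulr_ge0 ?frob2_ge0 ?invr_ge0 ?exprn_ge0 ?(ltW kappa0)//; lra.
have W0 := mgf_mean0 P W u0 _ mW u00 DV0 mgfW.
have iW := mgf_integrable P W u0 _ mW u00 mgfW.
have EZ : Ef P Z = e.
  rewrite /Ef unlock.
  have -> : (\int[P]_w (Z w)%:E = \int[P]_w (cst e%:E w + (K ^+ 2)%:E * (W w)%:E))%E.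
    by apply: eq_integral => w _; rewrite ZW.
  rewrite integralD//; [|exact: finite_measure_integrable_cst|exact: integrableZl].
  by rewrite integral_cst//= probability_setT mule1 integralZl// W0 mule0 adde0.
(* Since $K^2 = 4\kappa^2$, the level for [W] is $t/4$. *)
have -> : [set w | kappa ^+ 2 * t <= `|Z w - Ef P Z|] = [set w | t / 4 <= `|W w|].
  apply/funext => w /=; congr is_true.
  rewrite EZ ZW addrAC subrr add0r normrM (ger0_norm (sqr_ge0 K)).
  have -> : K ^+ 2 * `|W w| = kappa ^+ 2 * (`|W w| * 4) by rewrite /K; ring.
  by rewrite ler_pM2l ?exprn_gt0// ler_pdivrMr.
have t4 : 0 <= t / 4 by rewrite divr_ge0.
apply: (le_trans (chernoff_two_sided P W u0 _ mW u00 DV0 mgfW (t / 4) t4)).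
rewrite lee_fin; apply: ler_pM; rewrite ?expR_ge0// ?ler_nat// ler_expR mulNr lerN2.
have h0 : 0 <= 2^-1 :> R by rewrite invr_ge0.
rewrite [leRHS]minr_pMr// le_min; apply/andP; split.
  apply: (@le_trans _ _ ((1024 * D)^-1 * (t ^+ 2 / V))).
    by rewrite ler_wpM2l ?(ltW c0)// ge_min lexx.
  (* If [V] vanishes, both quotients are 0 by the convention on division. *)
  have [->|Vn] := eqVneq V 0; first by rewrite !mulr0 invr0 !mulr0.
  by rewrite le_eqVlt; apply/orP; left; apply/eqP; field; rewrite Vn gt_eqF.
apply: (@le_trans _ _ ((1024 * D)^-1 * (t / spec_norm A))).
  by rewrite ler_wpM2l ?(ltW c0)// ge_min lexx orbT.
have -> : 2^-1 * (u0 * (t / 4)) = 8 * ((1024 * D)^-1 * (t / spec_norm A)).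
  by rewrite /u0; field; rewrite !gt_eqF.
have : 0 <= (1024 * D)^-1 * (t / spec_norm A).
  by rewrite mulr_ge0 ?(ltW c0)// divr_ge0// ltW.
lra.
Qed.
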